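(* Let $X$ be a nonempty set, $\Sigma$ a $\sigma$-algebra on $X$, $\mathcal E\subseteq\Sigma$ a nonempty collection and $\mathcal E^0:=\mathcal E\setminus\{\emptyset\}$. Let $\mathfrak A_{\mathcal E}$ be the class of all FCAs on $\mathcal E^0$, $\mathfrak Z_{\mathcal E}$ the subclass of FCAs that are consistent under zero extension, and $\mathfrak T_{\mathcal E}$ the subclass of trace-generated FCAs. Then $$\mathfrak T_{\mathcal E}\subseteq\mathfrak Z_{\mathcal E}\subseteq\mathfrak A_{\mathcal E}.$$ In general each inclusion can be strict for a suitable context system: there exists a choice of $(X,\Sigma,\mathcal E)$ with $\mathfrak T_{\mathcal E}\subsetneq\mathfrak Z_{\mathcal E}$, and there exists a choice of $(X,\Sigma,\mathcal E)$ with $\mathfrak Z_{\mathcal E}\subsetneq\mathfrak A_{\mathcal E}$. If $X\in\mathcal E^0$, then $\mathfrak T_{\mathcal E}=\mathfrak Z_{\mathcal E}$.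
   Context: $\mathbf F$ is the class of all nonnegative bounded $\Sigma$-measurable functions $X\to[0,\infty)$, ordered pointwise. For $E\in\mathcal E^0$, $\Sigma_E=\{B\cap E:B\in\Sigma\}$ and $\mathbf F_E$ is the class of all nonnegative bounded $\Sigma_E$-measurable functions on $E$, ordered pointwise. $0_E$ and $0_X$ are the zero functions on $E$ and on $X$. An FCA (family of conditional aggregation operators) on $\mathcal E^0$ is represented by a family $\mathbf G=\{G_E:E\in\mathcal E^0\}$ of functionals $G_E\colon\mathbf F_E\to[0,\infty]$, each nondecreasing for the pointwise order and satisfying $G_E(0_E)=0$. Zero extension: for $F\subseteq E$ and a function $v$ on $F$, $Z_{F,E}v$ is the function on $E$ equal to $v$ on $F$ and to $0$ on $E\setminus F$ (here $E$ may also be $X$). $\mathbf G$ is consistent under zero extension if $G_E(Z_{F,E}v)=G_F(v)$ for all $F\subseteq E$ in $\mathcal E^0$ and all $v\in\mathbf F_F$. $\mathbf G$ is trace-generated if there is a nondecreasing functional $\Phi\colon\mathbf F\to[0,\infty]$ with $\Phi(0_X)=0$ and $G_E(u)=\Phi(Z_{E,X}u)$ for all $E\in\mathcal E^0$, $u\in\mathbf F_E$. *)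

(* Defs.v *)
From HB Require Import structures.
From mathcomp Require Import all_boot all_order all_algebra.
From mathcomp Require Import all_classical all_reals all_analysis.
Set Implicit Arguments.
Unset Strict Implicit.
Unset Printing Implicit Defensive.
Import Order.TTheory GRing.Theory Num.Theory.
Import numFieldNormedType.Exports.
Local Open Scope classical_set_scope.
Local Open Scope ring_scope.

(* Bundled sigma-algebras on a plain type: unlike [measurableType], the carrier
   need not be pointed, so that it can be a subset [E] of [X] seen as a type. *)
Record sigma_field (T : Type) := SigmaField {
  sf_sets : set (set T);
  sf_sigma_algebra : sigma_algebra [set: T] sf_sets }.

Definition Sigma d (X : measurableType d) : sigma_field X :=
  SigmaField (sigma_algebra_measurable X).

(* {B `&` E | B in Sigma}, as sets of points of the subtype E: the set
   B `&` E is encoded as [set_val @^-1` B]. *)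
Definition Sigma_trace d (X : measurableType d) (E : set X) : sigma_field E :=
  SigmaField (sigma_algebra_preimage [set: E] set_val
    (sigma_algebra_measurable X)).

Record nnbm (R : realType) (T : Type) (S : sigma_field T) := NNBM {
  nnbm_fun :> T -> R;
  nnbm_ge0 : forall x, 0 <= nnbm_fun x;
  nnbm_bounded : bounded_fun nnbm_fun;
  nnbm_measurable : forall Y : set R, measurable Y -> sf_sets S (nnbm_fun @^-1` Y) }.

Notation bF R X := (nnbm R (Sigma X)).
Notation bF_on R E := (nnbm R (Sigma_trace E)).

Section zero.
Variables (R : realType) (T : Type) (S : sigma_field T).

Lemma zero_ge0 (x : T) : 0 <= cst (0 : R) x.
Proof. by []. Qed.

Lemma zero_bounded : bounded_fun (cst (0 : R) : T -> R).
Proof. by exists 0; split => // M M0 x _ /=; rewrite normr0 ltW. Qed.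

Lemma zero_measurable (Y : set R) :
  measurable Y -> sf_sets S ((cst (0 : R) : T -> R) @^-1` Y).
Proof.
have [S0 SC _] := sf_sigma_algebra S.
move=> _; rewrite preimage_cst; case: ifP => _ //.
by rewrite -(setD0 [set: T]); exact: SC.
Qed.

Definition nnbm0 : nnbm R S := NNBM zero_ge0 zero_bounded zero_measurable.
End zero.

Section zero_extension.
Variables (R : realType) (d : measure_display) (X : measurableType d).

Section to_whole_space.
Variables (E : set X) (mE : measurable E) (u : bF_on R E).

Lemma zext_ge0 x : 0 <= 'valL_0 u x.
Proof.
rewrite /valL_ /=; case: ('oinv_set_val x) => //= y; exact: nnbm_ge0.
Qed.

Lemma zext_bounded : bounded_fun ('valL_0 u : X -> R).
Proof.
have [M [Mr uM]] := nnbm_bounded u; exists (Num.max M 0); split.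
  exact: num_real.
move=> N; rewrite gt_max => /andP[MN N0] x _; rewrite /valL_ /=.
case: ('oinv_set_val x) => [y|] /=; last by rewrite normr0 ltW.
exact: uM.
Qed.

Lemma zext_measurable (Y : set R) :
  measurable Y -> sf_sets (Sigma X) (('valL_0 u : X -> R) @^-1` Y).
Proof.
move=> mY; have [B mB uB] := nnbm_measurable u mY.
have zin (x : X) (xE : x \in E) : 'valL_0 u x = u (SigSub xE).
  by rewrite -(sigLE E ('valL_0 u) x xE) valLK.
have zout (x : X) : x \notin E -> 'valL_0 u x = 0.
  by move=> xE; rewrite /valL_ /= oinv_set_val insubN.
have uBE (x : X) (xE : x \in E) : Y (u (SigSub xE)) = B x.
  have := congr1 (@^~ (SigSub xE)) uB.
  rewrite setTI; exact: esym.
move: ('valL_0 u : X -> R) zin zout => f zin zout.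
suff -> : f @^-1` Y =
    (B `&` E) `|` ((cst (0 : R) : X -> R) @^-1` Y `&` ~` E).
  apply: measurableU; first exact: measurableI.
  apply: measurableI; last exact: measurableC.
  by rewrite preimage_cst; case: ifP.
apply/seteqP; split => x; rewrite /preimage /=.
  have [xE|xE] := boolP (x \in E).
    by rewrite (zin _ xE) uBE => Bx; left; split => //; rewrite inE in xE.
  by rewrite zout // => Y0; right; split => //; rewrite notin_setE in xE.
move=> [[Bx /mem_set xE]|[Y0 nE]]; first by rewrite (zin _ xE) uBE.
by rewrite zout // notin_setE.
Qed.

(* Z_{E,X} u *)
Definition zextX : bF R X := NNBM zext_ge0 zext_bounded zext_measurable.
End to_whole_space.

Section restriction.
Variables (E : set X) (f : bF R X).

Lemma res_ge0 x : 0 <= sigL E f x.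
Proof. exact: nnbm_ge0. Qed.

Lemma res_bounded : bounded_fun (sigL E f).
Proof.
have [M [Mr fM]] := nnbm_bounded f; exists M; split => // N MN x _.
exact: fM.
Qed.

Lemma res_measurable (Y : set R) :
  measurable Y -> sf_sets (Sigma_trace E) (sigL E f @^-1` Y).
Proof.
move=> mY; exists (f @^-1` Y); first exact: nnbm_measurable.
by rewrite setTI.
Qed.

Definition nnbm_res : bF_on R E := NNBM res_ge0 res_bounded res_measurable.
End restriction.

(* Z_{F,E} v, meant for F `<=` E: the restriction to E of Z_{F,X} v *)
Definition zext (F E : set X) (mF : measurable F) (v : bF_on R F) : bF_on R E :=
  nnbm_res E (zextX mF v).

End zero_extension.
Arguments zext {R d X F} E mF v.

Record context_system d (X : measurableType d) := ContextSystem {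
  contexts :> set (set X);
  contexts_measurable : contexts `<=` measurable;
  contexts_neq0 : contexts !=set0 }.

Definition contexts0 d (X : measurableType d) (C : context_system X) :
  set (set X) := (C : set (set X)) `\ set0.

Lemma contexts0_measurable d (X : measurableType d) (C : context_system X)
  (E : contexts0 C) : measurable (set_val E).
Proof. by have [CE _] := set_valP E; exact: contexts_measurable CE. Qed.

(* nondecreasing functionals with values in [0, +oo] that vanish at 0 *)
Definition aggregation (R : realType) (T : Type) (S : sigma_field T)
    (Phi : nnbm R S -> \bar R) : Prop :=
  [/\ forall u, (0 <= Phi u)%E,
      forall u v : nnbm R S, (forall x, u x <= v x) -> (Phi u <= Phi v)%E
    & Phi (nnbm0 R S) = 0%E].

Section classes.
Variables (R : realType) (d : measure_display) (X : measurableType d).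
Variable C : context_system X.

Definition context_family := forall E : contexts0 C, bF_on R (set_val E) -> \bar R.

Definition zero_ext_consistent (G : context_family) : Prop :=
  forall F E : contexts0 C, set_val F `<=` set_val E ->
  forall v : bF_on R (set_val F),
    G E (zext (set_val E) (contexts0_measurable F) v) = G F v.

Definition trace_generated (G : context_family) : Prop :=
  exists Phi : bF R X -> \bar R, aggregation Phi /\
  forall (E : contexts0 C) (u : bF_on R (set_val E)),
    G E u = Phi (zextX (contexts0_measurable E) u).

Definition FCA : set context_family := [set G | forall E, aggregation (G E)].

Definition FCA_consistent : set context_family :=
  [set G | FCA G /\ zero_ext_consistent G].

Definition FCA_trace : set context_family :=
  [set G | FCA G /\ trace_generated G].

End classes.
Arguments FCA R {d X} C.
Arguments FCA_consistent R {d X} C.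
Arguments FCA_trace R {d X} C.

(* Main.v *)
(* If [X] is a context, a consistent family is generated by its own member
   [G_X].  The two strict inclusions come from one family: evaluation at a point
   [q] on the contexts that contain a point [p], and zero on the others.  On the
   incomparable contexts [~` [set p]] and [~` [set r]] it is vacuously
   consistent, but its two members disagree on the indicator of [q], so no trace
   functional exists.  On the nested contexts [~` [set p]] and [setT] the same
   indicator refutes consistency. *)
Require Import Defs.
From mathcomp Require Import all_boot all_order all_algebra.
From mathcomp Require Import all_classical all_reals all_analysis.
Import Order.TTheory GRing.Theory Num.Theory.
Local Open Scope classical_set_scope.

Lemma nnbm_ext {R : realType} {T : Type} {S : sigma_field T} (u v : nnbm R S) :
  u =1 v -> u = v.
Proof.
case: u v => [u u0 ub um] [v v0 vb vm] /= /funext uv.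
move: v0 vb vm; rewrite -uv => v0 vb vm.
by congr NNBM; exact: Prop_irrelevance.
Qed.

Section zero_extension_theory.
Context {R : realType} {d : measure_display} {X : measurableType d}.
Implicit Types (E F : set X) (f : bF R X).

Lemma zextX_in E (mE : measurable E) (u : bF_on R E) x (xE : x \in E) :
  zextX mE u x = u (SigSub xE).
Proof. by rewrite -(sigLE E (zextX mE u) x xE) valLK. Qed.

Lemma zextX_out E (mE : measurable E) (u : bF_on R E) x :
  x \notin E -> zextX mE u x = 0%R.
Proof. by move=> xE; rewrite /= /valL_ /= oinv_set_val insubN. Qed.

Lemma le_zextX E (mE : measurable E) (u v : bF_on R E) :
  (forall x, u x <= v x)%R -> forall x, (zextX mE u x <= zextX mE v x)%R.
Proof.
move=> uv x; have [xE|xE] := boolP (x \in E); first by rewrite !zextX_in.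
by rewrite !zextX_out.
Qed.

Lemma zextX0 E (mE : measurable E) :
  zextX mE (nnbm0 R (Sigma_trace E)) = nnbm0 R (Sigma X).
Proof.
apply: nnbm_ext => x; have [xE|xE] := boolP (x \in E).
  by rewrite zextX_in.
by rewrite zextX_out.
Qed.

(** A function on [X] supported in [E] is recovered from its trace on [E]. Test functions can thus
    be chosen once on [X] and then restricted to each context. *)
Lemma zextX_res E (mE : measurable E) f :
  (forall x, ~ E x -> f x = 0%R) -> zextX mE (nnbm_res E f) = f.
Proof.
move=> f0; apply: nnbm_ext => x; have [xE|xE] := boolP (x \in E).
  by rewrite zextX_in.
by rewrite zextX_out// f0// -notin_setE.
Qed.

(** Extending in two stages agrees with extending at once, because [zextX mF v] already vanishes off
    [F], hence off [E]. Under a trace functional both sides of the consistency equation therefore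
    become the same value of [Phi]. *)
Lemma zextX_zext F E (mF : measurable F) (mE : measurable E) (v : bF_on R F) :
  F `<=` E -> zextX mE (zext E mF v) = zextX mF v.
Proof.
move=> FE; apply: zextX_res => x nEx; apply: zextX_out.
by rewrite notin_setE => /FE.
Qed.

End zero_extension_theory.

Section indicator.
Context {R : realType} {d : measure_display} {X : measurableType d}.
Context {A : set X} (mA : measurable A).

Lemma indic_nnbm_ge0 x : (0 <= \1_A x :> R)%R.
Proof. by rewrite indicE ler0n. Qed.

Lemma indic_nnbm_bounded : bounded_fun (\1_A : X -> R)%R.
Proof.
exists 1%R; split => // M M1 x _ /=; rewrite indicE normr_nat.
by case: (x \in A); rewrite ltW// (lt_trans _ M1).
Qed.

Lemma indic_nnbm_measurable (Y : set R) :
  measurable Y -> sf_sets (Sigma X) ((\1_A : X -> R)%R @^-1` Y).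
Proof.
move=> _; rewrite preimage_indic -[sf_sets _]/measurable.
by do 2!case: ifP => _ //; exact: measurableC.
Qed.

Definition indic_nnbm : bF R X :=
  NNBM indic_nnbm_ge0 indic_nnbm_bounded indic_nnbm_measurable.

End indicator.

Section inclusions.
Context {R : realType} {d : measure_display} {X : measurableType d}.
Variable C : context_system X.

Lemma FCA_trace_consistent : FCA_trace R C `<=` FCA_consistent R C.
Proof.
move=> G [GA [Phi [_ GPhi]]]; split => // F E FE v.
by rewrite !GPhi zextX_zext.
Qed.

Lemma FCA_consistent_trace :
  contexts0 C [set: X] -> FCA_consistent R C `<=` FCA_trace R C.
Proof.
move=> CX G [GA Gc]; split => //.
pose T : contexts0 C := SigSub (mem_set CX).
have [G0 Gle Gz] := GA T.
(* Restriction to the full set only changes the carrier from [X] to a subtype, so order and zero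
   pass from [G T] to this functional. *)
exists (fun f => G T (nnbm_res (set_val T) f)); split.
  split => [u|u v uv|]; [exact: G0 | by apply: Gle => x; exact: uv |].
  by rewrite -[RHS]Gz; congr (G T _); exact: nnbm_ext.
(* The restriction to [T] of the extension of [u] to [X] is by definition [zext] from [E] to [T], so
   the claim is consistency for the pair [E], [T]. *)
by move=> E u; rewrite -(Gc E T).
Qed.

End inclusions.

Section gated_evaluation.
Context {R : realType} {d : measure_display} {X : measurableType d}.
Variables (C : context_system X) (p q : X).

(** Reading [u] at [q] through [zextX] gives the default value 0 when [q] lies outside [E]. *)
Definition gated_eval : context_family R C := fun E u =>
  if p \in set_val E then (zextX (contexts0_measurable E) u q)%:E else 0%E.

Lemma gated_eval_FCA : FCA R C gated_eval.
Proof.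
move=> E; rewrite /gated_eval; split => [u|u v uv|]; case: ifP => _ //.
- by rewrite lee_fin nnbm_ge0.
- by rewrite lee_fin le_zextX.
- by rewrite zextX0.
Qed.

(** The evaluation at [q] does not see zero extension, so only a change of the gate at [p] between
    [F] and [E] can break consistency. *)
Lemma gated_eval_zext (F E : contexts0 C) (v : bF_on R (set_val F)) :
  set_val F `<=` set_val E -> (p \in set_val E) = (p \in set_val F) ->
  gated_eval E (zext (set_val E) (contexts0_measurable F) v) = gated_eval F v.
Proof. by move=> FE pEF; rewrite /gated_eval pEF zextX_zext. Qed.

Lemma gated_eval_res (E : contexts0 C) (f : bF R X) :
  (forall x, ~ set_val E x -> f x = 0%R) ->
  gated_eval E (nnbm_res (set_val E) f) =
  if p \in set_val E then (f q)%:E else 0%E.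
Proof. by move=> f0; rewrite /gated_eval zextX_res. Qed.

End gated_evaluation.

Section two_contexts.
Context {d : measure_display} {X : measurableType d}.
Context {A B : set X} (mA : measurable A) (mB : measurable B).

Lemma context_pair_measurable : [set A; B] `<=` measurable.
Proof. by move=> _ [->|->]. Qed.

Lemma context_pair_neq0 : [set A; B] !=set0.
Proof. by exists A; left. Qed.

Definition context_pair : context_system X :=
  ContextSystem context_pair_measurable context_pair_neq0.

Lemma context_pairl {x} : A x -> contexts0 context_pair A.
Proof. by move=> Ax; split; [left | move=> A0; rewrite A0 in Ax]. Qed.

Lemma context_pairr {x} : B x -> contexts0 context_pair B.
Proof. by move=> Bx; split; [right | move=> B0; rewrite B0 in Bx]. Qed.

Lemma context_pairP (E : contexts0 context_pair) :
  set_val E = A \/ set_val E = B.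
Proof. by have [] := set_valP E. Qed.

End two_contexts.
Arguments context_pairP {d X A B mA mB} E.

Section strictness.
Variables (R : realType) (d : measure_display) (X : measurableType d).
Variables (p q r : X).
Hypotheses (mp : measurable [set p]) (mq : measurable [set q]).
Hypotheses (mr : measurable [set r]).
Hypotheses (qp : q <> p) (qr : q <> r) (pr : p <> r).

Let indic_off (E : set X) :
  E q -> forall x, ~ E x -> indic_nnbm (R := R) mq x = 0%R.
Proof.
move=> Eq x nEx; rewrite /= indicE memNset// => xq.
by apply: nEx; rewrite xq.
Qed.

Let indic_q : indic_nnbm (R := R) mq q = 1%R.
Proof. by rewrite /= indicE mem_set. Qed.

Lemma FCA_trace_proper :
  FCA_trace R (context_pair (measurableC mp) (measurableC mr)) `<`
  FCA_consistent R (context_pair (measurableC mp) (measurableC mr)).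
Proof.
set C := context_pair _ _; split; first exact: FCA_trace_consistent.
move=> /(_ (gated_eval C p q)) [].
  split; first exact: gated_eval_FCA.
  move=> F E FE v; apply: gated_eval_zext => //.
  (* Inclusion between contexts forces equality here: [p] lies in the complement of [r] only, and
     [r] in the complement of [p] only. *)
  congr (p \in _); apply/seteqP; split => // x.
  have [EA|EB] := context_pairP E; have [FA|FB] := context_pairP F;
    rewrite ?EA ?EB ?FA ?FB // in FE *.
    by have := FE p pr => /(_ erefl).
  by have := FE r (nesym pr) => /(_ erefl).
move=> _ [Phi [_ GPhi]].
pose E : contexts0 C :=
  SigSub (mem_set (context_pairl (measurableC mp) (measurableC mr) qp)).
pose F : contexts0 C :=
  SigSub (mem_set (context_pairr (measurableC mp) (measurableC mr) qr)).
(* Both contexts contain [q], so both traces extend back to the indicator of [q]. Its value under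
   [Phi] would be 0 by [E], which misses [p], and 1 by [F], which contains it. *)
have := GPhi E (nnbm_res (set_val E) (indic_nnbm mq)).
have := GPhi F (nnbm_res (set_val F) (indic_nnbm mq)).
rewrite !gated_eval_res; [|exact: indic_off ..].
rewrite !zextX_res; [|exact: indic_off ..].
rewrite indic_q (@mem_set _ (set_val F) p)//.
rewrite (@memNset _ (set_val E) p)/=; last by apply.
by move=> <- /eqP; rewrite eqe eq_sym oner_eq0.
Qed.

Lemma FCA_consistent_proper :
  FCA_consistent R (context_pair (measurableC mp) measurableT) `<`
  FCA R (context_pair (measurableC mp) measurableT).
Proof.
set C := context_pair _ _; split; first by move=> G [].
move=> /(_ _ (gated_eval_FCA C p q)) [_ Gc].
pose F : contexts0 C :=
  SigSub (mem_set (context_pairl (measurableC mp) measurableT qp)).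
pose E : contexts0 C :=
  SigSub (mem_set (context_pairr (measurableC mp) measurableT (x := q) I)).
have FE : set_val F `<=` set_val E by [].
(* Passing from [F] to [E] opens the gate at [p]: the extended indicator has value 1 on [E], while
   consistency demands its value 0 on [F]. *)
have := Gc F E FE (nnbm_res (set_val F) (indic_nnbm mq)).
rewrite gated_eval_res; last exact: indic_off.
rewrite /gated_eval zextX_zext// zextX_res; last exact: indic_off.
rewrite indic_q (@mem_set _ (set_val E) p)//.
rewrite (@memNset _ (set_val F) p)/=; last by apply.
by move=> /eqP; rewrite eqe oner_eq0.
Qed.

End strictness.

Theorem theorem4p3 (R : realType) :
  [/\ forall (d : measure_display) (X : measurableType d)
        (C : context_system X),
        FCA_trace R C `<=` FCA_consistent R C /\
        FCA_consistent R C `<=` FCA R C,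
      exists (d : measure_display) (X : measurableType d)
        (C : context_system X), FCA_trace R C `<` FCA_consistent R C,
      exists (d : measure_display) (X : measurableType d)
        (C : context_system X), FCA_consistent R C `<` FCA R C
    & forall (d : measure_display) (X : measurableType d)
        (C : context_system X), contexts0 C [set: X] ->
        FCA_trace R C = FCA_consistent R C].
Proof.
have mnat (n : nat) : measurable [set n] by [].
split.
- by move=> d X C; split; [exact: FCA_trace_consistent | move=> G []].
(* Any three distinct points with measurable singletons would do; here [p], [q], [r] are 0, 2, 1. *)
- by exists _, nat; eexists; exact: (@FCA_trace_proper R _ nat 0 2 1).
- by exists _, nat; eexists; exact: (@FCA_consistent_proper R _ nat 0 2).
- move=> d X C CX; apply/seteqP.
  by split; [exact: FCA_trace_consistent | exact: FCA_consistent_trace].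
Qed.
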